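(* Let $R$ be a weakly reversible ring. Then the polynomial ring $R[x]$ is simultaneously strongly right AB and strongly left AB (in other words, $R[x]$ is a strongly AB ring).
   Context: All rings are associative with identity, not necessarily commutative. In $R[x]$ the indeterminate $x$ commutes with the elements of $R$. For a subset $X$ of a ring $S$, $r_S(X)=\{s\in S: Xs=0\}$ and $l_S(X)=\{s\in S: sX=0\}$ are the right and left annihilators of $X$ in $S$. An element $a\in R$ is reversible if $l_R(a)=r_R(a)$. A ring $R$ is weakly reversible if for each non-zero $a\in R$ there is an integer $m>0$ such that $a^m$ is a non-zero reversible element of $R$. A right (resp. left) ideal of a ring $S$ is bounded if it contains a non-zero two-sided ideal of $S$. A ring $S$ is strongly right (resp. strongly left) AB if every non-zero right (resp. left) annihilator $r_S(X)$ (resp. $l_S(X)$), $X\subseteq S$, is bounded; $S$ is strongly AB if it is both strongly right AB and strongly left AB. *)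

(* Defs.v *)
From HB Require Import structures.
From mathcomp Require Import all_boot all_order all_algebra.
From mathcomp Require Import boolp classical_sets.

Set Implicit Arguments.
Unset Strict Implicit.
Unset Printing Implicit Defensive.

Import GRing.Theory.
Local Open Scope classical_set_scope.
Local Open Scope ring_scope.

Section StronglyAB.
Variable S : nzRingType.
Implicit Types (X A I : set S) (a : S).

(* Annihilators of arbitrary subsets are not decidable in general, hence
   [Prop]-valued sets rather than the boolean ideals of MathComp. *)
Definition r_ann X : set S := [set s | forall x, X x -> x * s = 0].
Definition l_ann X : set S := [set s | forall x, X x -> s * x = 0].

Definition reversible a : Prop := l_ann [set a] = r_ann [set a].

Definition weakly_reversible : Prop :=
  forall a, a != 0 ->
    exists m : nat, [/\ (0 < m)%N, a ^+ m != 0 & reversible (a ^+ m)].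

Definition two_sided_ideal I : Prop :=
  [/\ I 0,
      forall u v, I u -> I v -> I (u - v),
      forall s u, I u -> I (s * u)
    & forall u s, I u -> I (u * s)].

(* Only used for one-sided ideals, which annihilators are. *)
Definition bounded_ideal A : Prop :=
  exists I : set S, [/\ two_sided_ideal I, I <> [set 0] & I `<=` A].

Definition strongly_right_AB : Prop :=
  forall X, r_ann X <> [set 0] -> bounded_ideal (r_ann X).

Definition strongly_left_AB : Prop :=
  forall X, l_ann X <> [set 0] -> bounded_ideal (l_ann X).

Definition strongly_AB : Prop := strongly_right_AB /\ strongly_left_AB.

End StronglyAB.

Arguments weakly_reversible S : clear implicits.
Arguments strongly_right_AB S : clear implicits.
Arguments strongly_left_AB S : clear implicits.
Arguments strongly_AB S : clear implicits.

(* Main.v *)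
(** Let g be a non-zero polynomial of least degree with X g = 0, and let c be
    its leading coefficient.  Minimality gives c r = 0 => g r = 0 for r in R.
    In a weakly reversible ring every square-zero element is reversible.
    - If some such g has c^2 = 0, then g c = 0, so c b = 0, g b = 0 and b^2 = 0
      for every coefficient b of g: all of them are reversible.  Hence a c = 0
      implies c a = 0, then g a = 0, and finally a R g = 0.
    - If no such g has c^2 = 0, choose g with c reversible.  Then c^2 a = 0
      forces (c a)^2 = 0, so c a = 0; hence a c^2 = 0 implies a R g c = 0.
    In both cases X kills a polynomial e <> 0 (g, resp. g c) such that
    a (lead e) = 0 implies a R e = 0.  Peeling off leading coefficients of the
    elements of X then gives X R[x] e = 0.  The left-hand statement is the
    right-hand one over the opposite ring. *)
Require Import Defs.
From mathcomp Require Import all_boot all_order all_algebra.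
From mathcomp Require Import boolp classical_sets.

Set Implicit Arguments.
Unset Strict Implicit.
Unset Printing Implicit Defensive.

Import GRing.Theory.
Local Open Scope ring_scope.

Section Reversible.
Variable R : nzRingType.
Implicit Types a c s w x : R.

Lemma reversibleP a : reversible a <-> forall x, x * a = 0 <-> a * x = 0.
Proof.
split=> [ha x | ha].
  have := congr1 (fun A : set R => A x) ha; rewrite /l_ann /r_ann /= => E.
  by split=> h; [have : forall y, y = a -> y * x = 0 by rewrite -E => _ ->
    | have : forall y, y = a -> x * y = 0 by rewrite E => _ ->]; apply.
apply/seteqP; split=> x /= h _ ->.
  exact/(ha x)/h.
exact/(ha x)/h.
Qed.

(** Moving [c] to the left of [a] leaves room for [s] on the right; then [c] is moved back. *)
Lemma reversible_insert a s c :
  reversible c -> a * c = 0 -> a * s * c = 0.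
Proof.
move=> /reversibleP hc /hc ca; apply/hc.
by rewrite mulrA ca mul0r.
Qed.

(** All powers of [w] beyond the first vanish, so the exponent supplied for [w] can only be 1. *)
Lemma sqr0_reversible w :
  weakly_reversible R -> w * w = 0 -> reversible w.
Proof.
move=> hR ww; have [-> | w0] := eqVneq w 0.
  by apply/reversibleP => x; rewrite mulr0 mul0r.
have [[|[|m]] [// _ wm0 _]] := hR w w0.
by move: wm0; rewrite !exprS mulrA ww mul0r eqxx.
Qed.

End Reversible.

Section MinimalAnnihilator.
Variables (R : nzRingType) (X : set {poly R}).
Implicit Types (e f g h : {poly R}) (a r s : R).

Definition minimal_annihilated g : Prop :=
  [/\ g != 0, r_ann X g
    & forall h, h != 0 -> r_ann X h -> (size g <= size h)%N].

Lemma exists_minimal_annihilated g :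
  g != 0 -> r_ann X g -> exists g', minimal_annihilated g'.
Proof.
elim: (size g) {-2}g (leqnn (size g)) => [|n IHn] {}g.
  by rewrite size_poly_leq0 => ->.
move=> gn g0 Xg.
have [[h [h0 Xh hg]] | noh] :=
  pselect (exists h, [/\ h != 0, r_ann X h & (size h < size g)%N]).
  by apply: IHn h0 Xh; rewrite -ltnS (leq_trans hg).
exists g; split=> // h h0 Xh; rewrite leqNgt; apply/negP => hg.
by apply: noh; exists h.
Qed.

Lemma size_mulC_leq g r : (size (g * r%:P)%R <= size g)%N.
Proof.
by apply/leq_sizeP => j hj; rewrite coefMC nth_default ?mul0r.
Qed.

Lemma r_ann_mulr g h : r_ann X g -> r_ann X (g * h).
Proof. by move=> Xg f Xf; rewrite mulrA Xg ?mul0r. Qed.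

(** Otherwise [g * r%:P] would be a non-zero polynomial killed by [X], of smaller size than [g]. *)
Lemma minimal_annihilated_coef0 g r : minimal_annihilated g ->
  lead_coef g * r = 0 -> forall j, g`_j * r = 0.
Proof.
move=> [g0 Xg gmin] cr j; rewrite -coefMC.
have [-> | gr0] := eqVneq (g * r%:P) 0; first by rewrite coef0.
have le_g := gmin _ gr0 (r_ann_mulr _ Xg).
have /eqP eq_g : size (g * r%:P) == size g by rewrite eqn_leq size_mulC_leq.
move: gr0; rewrite -lead_coef_eq0 lead_coefE eq_g coefMC -lead_coefE cr.
by rewrite eqxx.
Qed.

Lemma minimal_annihilated_mulC g r : minimal_annihilated g ->
  lead_coef g * r != 0 ->
  minimal_annihilated (g * r%:P) /\ lead_coef (g * r%:P) = lead_coef g * r.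
Proof.
move=> [g0 Xg gmin] cr.
have gr0 : g * r%:P != 0.
  apply: contra_neq cr => gr.
  by rewrite lead_coefE -coefMC gr coef0.
have Xgr := r_ann_mulr r%:P Xg.
have /eqP eq_g : size (g * r%:P) == size g.
  by rewrite eqn_leq size_mulC_leq gmin.
split; last by rewrite !lead_coefE eq_g coefMC.
by split=> // h h0 Xh; rewrite eq_g gmin.
Qed.

Definition lead_controlled e : Prop :=
  forall a s j, a * lead_coef e = 0 -> a * s * e`_j = 0.

(** Induction on the size of [f]: its leading coefficient kills [R e], so removing the leading term
    leaves a shorter polynomial that still kills [e]. *)
Lemma lead_controlled_annihilates e : lead_controlled e ->
  forall f, f * e = 0 -> forall i j s, f`_i * s * e`_j = 0.
Proof.
move=> he f; elim: (size f) {-2}f (leqnn (size f)) => [|n IHn] {}f.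
  by rewrite size_poly_leq0 => /eqP-> _ i j s; rewrite coef0 !mul0r.
move=> fn fe.
have [-> i j s | f0] := eqVneq f 0; first by rewrite coef0 !mul0r.
have ae s j : lead_coef f * s * e`_j = 0.
  by apply: he; rewrite mul_lead_coef fe coef0.
pose f' := f - (lead_coef f)%:P * 'X^((size f).-1).
have coef_f' i : f'`_i = if i == (size f).-1 then 0 else f`_i.
  rewrite coefB coefCM coefXn lead_coefE.
  by case: eqP => [->|_]; rewrite ?mulr1 ?subrr // mulr0 subr0.
have f'n : (size f' <= n)%N.
  apply/leq_sizeP => i ni; rewrite coef_f'; case: eqP => // /eqP i_neq.
  rewrite nth_default // -(prednK (_ : 0 < size f)%N) ?size_poly_gt0 //.
  by rewrite ltn_neqAle eq_sym i_neq (leq_trans _ ni) // -ltnS prednK ?size_poly_gt0.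
have f'e : f' * e = 0.
  rewrite mulrBl fe sub0r -mulrA -commr_polyXn mulrA.
  suff -> : (lead_coef f)%:P * e = 0 by rewrite mul0r oppr0.
  by apply/polyP => j; rewrite coefCM coef0 -[lead_coef f]mulr1 ae.
move=> i j s; have := IHn _ f'n f'e i j s; rewrite coef_f'.
by case: eqP => [-> _ | //]; rewrite -lead_coefE ae.
Qed.

Hypothesis hR : weakly_reversible R.

Lemma minimal_sqr0_lead_controlled g : minimal_annihilated g ->
  lead_coef g * lead_coef g = 0 -> lead_controlled g.
Proof.
move=> gmin; set c := lead_coef g => cc.
have ann r : c * r = 0 -> forall j, g`_j * r = 0.
  exact: minimal_annihilated_coef0.
have /reversibleP hc := sqr0_reversible hR cc.
move=> a s j /hc/ann/(_ j) gja.
have bj : reversible g`_j by apply/(sqr0_reversible hR)/ann/hc/ann.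
apply: (reversible_insert _ bj).
by move/reversibleP: bj => bj; apply/bj/gja.
Qed.

Lemma lead_controlled_mul_lead g : minimal_annihilated g ->
  reversible (lead_coef g) ->
  (forall h, minimal_annihilated h -> lead_coef h * lead_coef h != 0) ->
  lead_controlled (g * (lead_coef g)%:P).
Proof.
move=> gmin; set c := lead_coef g => /reversibleP hc nosqr0 a s j.
have [_ ->] := minimal_annihilated_mulC gmin (nosqr0 g gmin).
rewrite -/c mulrA => /hc cac.
(* Otherwise [g * a%:P] is minimal with leading coefficient [c * a], whose square [c * (a * c) * a]
   is zero. *)
have ca : c * a = 0.
  apply/eqP/negP => /negP ca.
  have [/nosqr0 + lead_ca] := minimal_annihilated_mulC gmin ca.
  by rewrite lead_ca -/c mulrA -(mulrA c a c) cac mul0r eqxx.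
(* The extra factor [c] at the right end moves to the front, where it meets [a]. *)
by rewrite coefMC mulrA; apply/hc; rewrite !mulrA ca !mul0r.
Qed.

Lemma exists_two_sided_annihilated g : g != 0 -> r_ann X g ->
  exists2 e, e != 0 & forall f h, X f -> f * h * e = 0.
Proof.
move=> g0 Xg.
suff [e [e0 Xe he]] : exists e, [/\ e != 0, r_ann X e & lead_controlled e].
  exists e => // f h Xf; apply/polyP => k; rewrite coef0 coefM.
  apply: big1 => i _; rewrite coefM mulr_suml; apply: big1 => l _.
  exact: (lead_controlled_annihilates he (Xe f Xf)).
have {g g0 Xg} [g gmin] := exists_minimal_annihilated g0 Xg.
have [[h [hmin hh]] | nosqr0] := pselect
    (exists h, minimal_annihilated h /\ lead_coef h * lead_coef h = 0).
  exists h; split; [by case: hmin | by case: hmin |].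
  exact: minimal_sqr0_lead_controlled.
have {}nosqr0 h : minimal_annihilated h -> lead_coef h * lead_coef h != 0.
  by move=> hmin; apply/eqP => hh; apply: nosqr0; exists h.
have c0 : lead_coef g != 0 by rewrite lead_coef_eq0; case: gmin.
have [[|m] [// _ cm0 cm_rev]] := hR c0; rewrite exprS in cm0 cm_rev.
(* Multiplying [g] by the [m]-th power of its leading coefficient raises that coefficient to the
   reversible power [m.+1]. *)
have [hmin lead_h] := minimal_annihilated_mulC gmin cm0.
rewrite -lead_h in cm_rev; move: (g * _) hmin cm_rev => h hmin h_rev.
have [[e0 Xe _] _] := minimal_annihilated_mulC hmin (nosqr0 h hmin).
by exists (h * (lead_coef h)%:P); split=> //; apply: lead_controlled_mul_lead.
Qed.

End MinimalAnnihilator.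

Section Converse.
Variable R : nzRingType.

Lemma weakly_reversible_converse :
  weakly_reversible R -> weakly_reversible R^c.
Proof.
move=> hR a /hR[m [m0 am0 /reversibleP am]]; exists m.
have E : (a : R^c) ^+ m = (a : R) ^+ m.
  by elim: (m) => // n IHn; rewrite exprS IHn exprSr.
rewrite E; split=> //; apply/reversibleP => x.
by split=> /(am x).
Qed.

(** The anti-isomorphism from R[x] to polynomials over the opposite ring, which turns left
    annihilators into right ones. *)
Definition poly_converse (p : {poly R}) : {poly R^c} := \poly_(i < size p) (p`_i : R^c).

Lemma coef_poly_converse p i : (poly_converse p)`_i = p`_i.
Proof.
by rewrite coef_poly; case: ltnP => // ?; rewrite nth_default.
Qed.

Lemma poly_converseM p q :
  poly_converse (p * q) = poly_converse q * poly_converse p.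
Proof.
apply/polyP => i; rewrite coef_poly_converse coefM coefMr.
by apply: eq_bigr => j _; rewrite !coef_poly_converse.
Qed.

Lemma poly_converse_eq0 p : poly_converse p = 0 <-> p = 0.
Proof.
split=> /polyP p0; apply/polyP => i; have := p0 i;
  by rewrite coef_poly_converse !coef0.
Qed.

Lemma poly_converse_surj q : exists p, poly_converse p = q.
Proof.
exists (\poly_(i < size q) (q`_i : R)); apply/polyP => i.
rewrite coef_poly_converse coef_poly.
by case: ltnP => // ?; rewrite nth_default.
Qed.

End Converse.

Lemma neq_set0_exists (S : nzRingType) (A : set S) :
  A <> [set 0]%classic -> A 0 -> exists2 g, g != 0 & A g.
Proof.
move=> An0 A0; apply: contrapT => noA; apply: An0.
apply/seteqP; split=> [g Ag | _ -> //] /=.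
by apply/eqP/negP => /negP g0; apply: noA; exists g.
Qed.

Theorem theorem2p18 (R : nzRingType) (hR : weakly_reversible R) :
  strongly_AB {poly R}.
Proof.
split=> X /neq_set0_exists.
  case=> [f _ | g g0 Xg]; first by rewrite mulr0.
  have [e e0 he] := exists_two_sided_annihilated hR g0 Xg.
  (* This is the largest two-sided ideal inside [r_ann X]; taking [h = 1] gives the inclusion. *)
  exists [set u | forall f h, X f -> f * h * u = 0]%classic; split.
  - split=> /= [f h _ | u v hu hv f h Xf | s u hu f h Xf | u s hu f h Xf].
    + by rewrite mulr0.
    + by rewrite mulrBr hu // hv // subr0.
    + by rewrite mulrA -(mulrA f) hu.
    + by rewrite mulrA hu // mul0r.
  - move/seteqP => [/(_ e he) /= e_eq0 _].
    by rewrite e_eq0 eqxx in e0.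
  - by move=> u hu f Xf; rewrite -[f]mulr1 hu.
case=> [f _ | g g0 gX]; first by rewrite mul0r.
pose Xc := [set q : {poly R^c} | exists2 f, X f & q = poly_converse f]%classic.
have gc0 : poly_converse g != 0 by apply: contra_neq g0 => /poly_converse_eq0.
have Xgc : r_ann Xc (poly_converse g).
  by move=> _ [f Xf ->]; rewrite -poly_converseM gX //; apply/poly_converse_eq0.
have [ec] := exists_two_sided_annihilated (weakly_reversible_converse hR) gc0 Xgc.
have [e <- e0 he] := poly_converse_surj ec.
exists [set u | forall f h, X f -> u * h * f = 0]%classic; split.
- split=> /= [f h _ | u v hu hv f h Xf | s u hu f h Xf | u s hu f h Xf].
  + by rewrite !mul0r.
  + by rewrite !mulrBl hu // hv // subr0.
  + by rewrite -!mulrA (mulrA u) hu // mulr0.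
  + by rewrite -(mulrA u) hu.
- move/seteqP => [+ _] => /(_ e) e_eq0.
  (* Membership of [e] is checked in the opposite ring, where [e * h * f] becomes a product ending
     in the image of [e]. *)
  case/eqP: e0; apply/poly_converse_eq0/e_eq0 => f h Xf.
  apply/poly_converse_eq0; rewrite !poly_converseM mulrA.
  by apply: he; exists f.
- by move=> u hu f Xf; rewrite -[u]mulr1 hu.
Qed.
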